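(* Let $p$ be a prime with $p\ne 3$, let $q=p^k$ where $k$ is a positive integer, and let $Q,R,S\in\{p^i : i\ge 0\}$. Let $\omega\in\mathbb{F}_{q^2}^*$ be an element of multiplicative order $3$, and let $r$ be a positive integer such that $r\equiv Q+R+S\pmod{q+1}$. Define \begin{align*} C_1(X) := {} & (\omega^{Q+R+S}-\omega) X^{Q+R+S} + (\omega^{Q+R}-\omega^{S+1}) X^{Q+R} \\ & + (\omega^{Q+S}-\omega^{R+1}) X^{Q+S} + (\omega^{R+S}-\omega^{Q+1}) X^{R+S} \\ & + (\omega^Q-\omega^{R+S+1}) X^Q + (\omega^R-\omega^{Q+S+1}) X^R \\ & + (\omega^S-\omega^{Q+R+1}) X^S + (1-\omega^{Q+R+S+1}) \end{align*} and $C_2(X) := X^{Q+R+S} C_1(1/X)$. Let $\beta=\omega^{Q+R}-\omega^{S+1}$ if $Q+R+S\equiv 1\pmod 3$, and $\beta=\omega^{Q+R+S}-\omega$ otherwise, and write $B_z(X) := C_z(X)/\beta$ for each $z\in\{1,2\}$. Then for each $z\in\{1,2\}$: (i) $B_z(X)$ has at most five terms, its coefficients are in $\mathbb{F}_p$, and if the integers $Q,R,S$ are pairwise distinct then the coefficients of (the terms of) $B_z(X)$ are in $\{1,-1\}$. (ii) Let $e$ be the unique integer in $\{1,-1\}$ with $q\equiv e\pmod 3$. Then $f(X) := X^r B_z(X^{q-1})$ permutes $\mathbb{F}_{q^2}$ if and only if $\gcd(r,q-1)=1$ and $\gcd(Q+R+S,q+e)=1$.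
   Context: A polynomial $f(X)\in\mathbb{F}_{q^2}[X]$ permutes $\mathbb{F}_{q^2}$ if the function $\alpha\mapsto f(\alpha)$ is a bijection $\mathbb{F}_{q^2}\to\mathbb{F}_{q^2}$. The ''terms'' of a polynomial are its monomials with nonzero coefficient, and the assertion that the coefficients lie in $\{1,-1\}$ refers to these nonzero coefficients (as elements of $\mathbb{F}_p$). *)

(* Defs.v *)
From HB Require Import structures.
From mathcomp Require Import all_boot all_order all_algebra.
From mathcomp Require Import zify.

Set Implicit Arguments.
Unset Strict Implicit.
Unset Printing Implicit Defensive.

Import GRing.Theory.
Local Open Scope ring_scope.

(* The image of the prime field 'F_p under the canonical map to F; meaningful
   when p is the characteristic of F. *)
Definition in_Fp (p : nat) (F : nzRingType) (x : F) : Prop :=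
  exists a : 'F_p, x = (a : nat)%:R.

Definition nterms (F : nzRingType) (f : {poly F}) : nat :=
  count (fun c => c != 0) f.

Definition permutes (F : finFieldType) (f : {poly F}) : Prop :=
  bijective (fun a : F => f.[a]).

(* X^n f(1/X), a polynomial when deg f <= n; see [recip_polyE]. *)
Definition recip_poly (F : nzRingType) (n : nat) (f : {poly F}) : {poly F} :=
  \sum_(i < size f) f`_i *: 'X^(n - i).

Lemma recip_polyE (F : fieldType) (n : nat) (f : {poly F}) :
  (size f <= n.+1)%N ->
  @tofrac {poly F} (recip_poly n f) =
    (@tofrac {poly F} 'X) ^+ n * (map_poly (@tofrac {poly F} \o polyC) f).[(@tofrac {poly F} 'X)^-1]
    :> {fraction {poly F}}.
Proof.
move=> sz_f; have X0 : @tofrac {poly F} 'X != 0 :> {fraction {poly F}}.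
  by rewrite tofrac_eq0 polyX_eq0.
rewrite /recip_poly raddf_sum /= horner_coef size_map_poly mulr_sumr.
apply: eq_bigr => i _.
have le_in : (i <= n)%N by rewrite -ltnS (leq_trans (ltn_ord i)).
rewrite coef_map /= -mul_polyC tofracM tofracXn mulrCA; congr (_ * _).
by rewrite -{2}(subnK le_in) exprD -mulrA -exprMn divff // expr1n mulr1.
Qed.

Section Polynomials.
Variables (F : fieldType) (w : F) (Q R S : nat).

Definition C1 : {poly F} :=
  (w ^+ (Q + R + S) - w) *: 'X^(Q + R + S)
  + (w ^+ (Q + R) - w ^+ (S + 1)) *: 'X^(Q + R)
  + (w ^+ (Q + S) - w ^+ (R + 1)) *: 'X^(Q + S)
  + (w ^+ (R + S) - w ^+ (Q + 1)) *: 'X^(R + S)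
  + (w ^+ Q - w ^+ (R + S + 1)) *: 'X^Q
  + (w ^+ R - w ^+ (Q + S + 1)) *: 'X^R
  + (w ^+ S - w ^+ (Q + R + 1)) *: 'X^S
  + (1 - w ^+ (Q + R + S + 1))%:P.

Lemma size_C1 : (size C1 <= (Q + R + S).+1)%N.
Proof.
have le_sz m (a : F) : (m <= Q + R + S)%N ->
    (size (a *: 'X^m : {poly F}) <= (Q + R + S).+1)%N.
  by move=> le_m; rewrite (leq_trans (size_scale_leq _ _)) // size_polyXn.
rewrite /C1; do 7?[apply: leq_trans (size_polyD _ _) _; rewrite geq_max;
  apply/andP; split]; try by apply: le_sz; lia.
by rewrite (leq_trans (size_polyC_leq1 _)).
Qed.

Definition C2 : {poly F} := recip_poly (Q + R + S) C1.

Definition beta : F :=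
  if (Q + R + S == 1 %[mod 3])%N then w ^+ (Q + R) - w ^+ (S + 1)
  else w ^+ (Q + R + S) - w.

(* Only the indices z = 1 and z = 2 are meaningful. *)
Definition B (z : nat) : {poly F} :=
  beta^-1 *: (if z == 1%N then C1 else C2).

End Polynomials.

(* Main.v *)
(** In characteristic [p], with [n = Q + R + S], the polynomials [C1] and [C2]
    take the values [u^n - w v^n] and [v^n - w u^n], where [u = w x + 1] and
    [v = x + w].  On the [(q+1)]-st roots of unity, [x^r B(x)^(q-1)] is therefore
    [C2/C1] or [C1/C2], i.e., up to inversion, the conjugate of [t |-> t^n] by
    the Moebius map [u/v].  This map sends these roots of unity bijectively onto
    themselves when [q = 1] mod 3, and onto the projective line over the field
    with [q] elements when [q = -1] mod 3; so the induced map is injective if and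
    only if [n] is prime to [q + e].

    The coefficients are settled by the residues of [Q], [R], [S] mod 3. *)

Require Import Defs.
From HB Require Import structures.
From mathcomp Require Import all_boot all_order all_algebra.
From mathcomp Require Import cyclic finfield.
From mathcomp Require Import ring zify.

Set Implicit Arguments.
Unset Strict Implicit.
Unset Printing Implicit Defensive.

Import GRing.Theory.
Local Open Scope ring_scope.

(** * Powers and roots of unity in finite fields *)

Lemma exprD_pnat (R : comNzSemiRingType) (p n : nat) (x y : R) :
  p \in [pchar R] -> p.-nat n -> (x + y) ^+ n = x ^+ n + y ^+ n.
Proof.
move=> charR pn; apply: exprDn_pchar; apply: sub_in_pnat pn => l _.
by rewrite inE => /eqP ->.
Qed.

Lemma expr_coprime_eq1 (R : nzRingType) (m n : nat) (a : R) :
  (0 < m)%N -> coprime m n -> a ^+ m = 1 -> a ^+ n = 1 -> a = 1.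
Proof.
move=> m0 /eqP co am an; have [u v uv _] := egcdnP n m0.
have := congr1 (GRing.exp a) uv.
by rewrite co exprD !(mulnC _ m) !(mulnC _ n) !exprM am an !expr1n mul1r.
Qed.

Lemma expf_coprime_inj (F : fieldType) (m n : nat) (a b : F) :
  (0 < m)%N -> coprime m n -> b != 0 ->
  a ^+ m = b ^+ m -> a ^+ n = b ^+ n -> a = b.
Proof.
move=> m0 co b0 abm abn; have bX k : b ^+ k != 0 by rewrite expf_neq0.
apply: (divIf b0); rewrite divff //.
by apply: (expr_coprime_eq1 m0 co); rewrite expr_div_n ?abm ?abn divff.
Qed.

Lemma expf_card_pred (F : finFieldType) (x : F) : x != 0 -> x ^+ #|F|.-1 = 1.
Proof.
move=> x0; have F1 : (1 < #|F|)%N := finNzRing_gt1 F.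
by apply: (mulfI x0); rewrite -exprS prednK ?expf_card ?mulr1 // ltnW.
Qed.

Lemma finField_prim_root (F : finFieldType) :
  {g : F | (#|F|.-1).-primitive_root g}.
Proof.
have F1 : (1 < #|F|)%N := finNzRing_gt1 F.
have : has (#|F|.-1).-primitive_root [seq x : F <- enum F | x != 0].
  apply: has_prim_root; first lia.
  - apply/allP => x; rewrite mem_filter => /andP[x0 _]; apply/eqP.
    by rewrite !hornerE expf_card_pred ?subrr.
  - by rewrite filter_uniq ?enum_uniq.
  - rewrite size_filter -(leq_add2l (count_mem (0 : F) (enum F))).
    rewrite (count_predC (pred1 0)) -cardT count_uniq_mem ?enum_uniq //.
    by rewrite mem_enum inE add1n prednK ?(ltnW F1).
by move/hasP/sig2W => [g _ ?]; exists g.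
Qed.

(** The multiplicative group is cyclic, so it has an element of order [gcdn n m], which exceeds
    1. *)
Lemma finField_root_of_unity_neq1 (F : finFieldType) (m n : nat) :
  (m %| #|F|.-1)%N -> ~~ coprime n m -> 
  exists x : F, [/\ x != 1, x ^+ m = 1 & x ^+ n = 1].
Proof.
move=> mF co; have F1 : (1 < #|F|)%N := finNzRing_gt1 F.
have [g prim_g] := finField_prim_root F.
have dF : (gcdn n m %| #|F|.-1)%N by rewrite (dvdn_trans (dvdn_gcdr n m)).
have prim_x := dvdn_prim_root prim_g dF; set x := g ^+ _ in prim_x.
exists x; split; last 2 first.
- by apply/eqP; rewrite -(prim_order_dvd prim_x) dvdn_gcdr.
- by apply/eqP; rewrite -(prim_order_dvd prim_x) dvdn_gcdl.
- by rewrite -(expr1 x) -(prim_order_dvd prim_x) dvdn1.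
Qed.

(* Every [c] with [c ^+ s = 1] is an [r]-th power of such an element when [r]
   is prime to [s], so a collision of [x ^+ r * h.[x] ^+ s] on the [d]-th roots
   of unity lifts to one of the polynomial. *)
Lemma permutes_comp_exp (F : finFieldType) (r s d : nat) (h : {poly F}) :
  (0 < r)%N -> (d * s)%N = #|F|.-1 ->
  (forall x, x ^+ d = 1 -> h.[x] != 0) ->
  permutes ('X^r * (h \Po 'X^s)) <->
  coprime r s /\
  (forall x y : F, x ^+ d = 1 -> y ^+ d = 1 ->
     x ^+ r * h.[x] ^+ s = y ^+ r * h.[y] ^+ s -> x = y).
Proof.
move=> r0 ds h0; have F1 : (1 < #|F|)%N := finNzRing_gt1 F.
have fE a : ('X^r * (h \Po 'X^s)).[a] = a ^+ r * h.[a ^+ s].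
  by rewrite hornerM horner_comp !hornerXn.
have mu (a : F) : a != 0 -> (a ^+ s) ^+ d = 1.
  by move=> a0; rewrite -exprM mulnC ds; exact: expf_card_pred.
have [g prim_g] := finField_prim_root F.
(* In a cyclic group of order [d * s] the [d]-th roots of unity are exactly the [s]-th powers. *)
have muP x : x ^+ d = 1 -> exists2 a : F, a != 0 & x = a ^+ s.
  have := dvdn_prim_root prim_g (_ : d %| _)%N.
  rewrite -ds dvdn_mulr // mulKn; last by lia.
  move=> /(_ isT) prim_d /(prim_rootP prim_d)[i ->].
  exists (g ^+ i); last by rewrite exprAC.
  by rewrite expf_neq0 // (prim_root_eq0 prim_g) -ds; lia.
split=> [/bij_inj f_inj | [co g_inj]].
- have {}f_inj a b : a ^+ r * h.[a ^+ s] = b ^+ r * h.[b ^+ s] -> a = b.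
    by rewrite -!fE => /f_inj.
  have co : coprime r s.
    apply: contraT => /(finField_root_of_unity_neq1 (F := F)).
    rewrite -ds dvdn_mull // => /(_ isT) [x [x1 xs xr]].
    by rewrite (f_inj x 1) ?eqxx // xs xr !expr1n in x1.
  split=> // _ _ /muP[a a0 ->] /muP[b b0 ->] eq_g.
  set A := a ^+ r * h.[a ^+ s]; set B := b ^+ r * h.[b ^+ s].
  have AB : A ^+ s = B ^+ s.
    by rewrite !exprMn (exprAC _ r s) (exprAC _ r s).
  have B0 : B != 0 by rewrite mulf_neq0 ?expf_neq0 // h0 // mu.
  have AcB : A = A / B * B by rewrite divfK.
  have : (A / B) ^+ s = 1 by rewrite expr_div_n AB divff // expf_neq0.
  move: (A / B) AcB => c AcB c1.
  have [u v] := egcdnP s r0; rewrite (eqP co) => uv _.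
  have -> : a = c ^+ u * b; last by rewrite exprMn exprAC c1 expr1n mul1r.
  apply: f_inj; rewrite !exprMn (exprAC _ u s) c1 expr1n mul1r -/A -exprM uv.
  by rewrite exprD mulnC exprM c1 expr1n mul1r expr1 -mulrA.
- apply: injF_bij => a b; rewrite !fE => fab.
  have f0 c : c != 0 -> c ^+ r * h.[c ^+ s] != 0.
    by move=> c0; rewrite mulf_neq0 ?expf_neq0 // h0 // mu.
  have [a0|a0] := eqVneq a 0.
    apply/eqP; rewrite a0 eq_sym; apply: contraT => /f0.
    by rewrite -fab a0 expr0n eqn0Ngt r0 mul0r eqxx.
  have [b0|b0] := eqVneq b 0.
    have := f0 _ a0.
    by rewrite fab b0 expr0n eqn0Ngt r0 mul0r eqxx.
  have abs : a ^+ s = b ^+ s.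
    apply: g_inj; rewrite ?mu //.
    by rewrite !(exprAC _ s r) -!exprMn fab.
  apply: (expf_coprime_inj r0 co b0) => //.
  by move: fab; rewrite abs => /mulIf -> //; rewrite h0 ?mu.
Qed.

(** * Sparse polynomials, term counts and reciprocal polynomials *)

(** Exponents may repeat, in which case the coefficients add up. This covers the coincidences among
    the exponents of [C1], such as [Q = R] or [Q + R = S]. *)
Definition sparse_poly (F : nzRingType) (s : seq (nat * F)) : {poly F} :=
  \sum_(t <- s) t.2 *: 'X^(t.1).

Lemma coef_sparse_poly_cons (F : nzRingType) (n : nat) (c : F) s i :
  (sparse_poly ((n, c) :: s))`_i = c *+ (i == n) + (sparse_poly s)`_i.
Proof.
by rewrite /sparse_poly big_cons coefD coefZ coefXn mulr_natr.
Qed.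

Lemma coef_sparse_poly_uniq (F : nzRingType) (s : seq (nat * F)) i :
  uniq (unzip1 s) -> (sparse_poly s)`_i = 0 \/ (sparse_poly s)`_i \in unzip2 s.
Proof.
have outside (t : seq (nat * F)) j : j \notin unzip1 t -> (sparse_poly t)`_j = 0.
  elim: t => [|[n c] t IH]; first by rewrite /sparse_poly big_nil coef0.
  rewrite coef_sparse_poly_cons inE negb_or => /andP[/negPf -> /IH ->].
  by rewrite addr0.
elim: s => [_|[n c] s IH /= /andP[ns us]].
  by left; rewrite /sparse_poly big_nil coef0.
rewrite coef_sparse_poly_cons inE; case: eqP => [->|_].
  by right; rewrite outside // addr0 eqxx.
by rewrite add0r; case: (IH us) => ->; [left | right; rewrite orbT].
Qed.

(** Indices past the size contribute nothing, so term counts of different polynomials can be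
    compared over one common range. *)
Lemma nterms_sum (F : nzRingType) (f : {poly F}) n : (size f <= n)%N ->
  nterms f = (\sum_(i < n) (f`_i != 0)%R)%N.
Proof.
move=> sz; rewrite /nterms -sum1_count big_mkcond /= (big_nth 0%R) big_mkord.
rewrite (big_ord_widen _ (fun i => if f`_i != 0 then 1%N else 0%N) sz).
rewrite big_mkcond; apply: eq_bigr => i _; case: ltnP => [_|le_i].
  by case: (_ != _).
by rewrite nth_default ?eqxx.
Qed.

Lemma ntermsD (F : nzRingType) (f g : {poly F}) :
  (nterms (f + g) <= nterms f + nterms g)%N.
Proof.
have leM : (size (f + g)%R <= maxn (size f) (size g))%N by apply: size_polyD.
rewrite (nterms_sum leM) (nterms_sum (leq_maxl (size f) (size g))).
rewrite (nterms_sum (leq_maxr (size f) (size g))) -big_split.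
apply: leq_sum => i _; rewrite coefD /=.
have [->|_] := eqVneq f`_i 0; first by rewrite add0r.
exact: leq_trans (leq_b1 _) (leq_addr _ _).
Qed.

Lemma nterms_sparse_poly (F : nzRingType) (s : seq (nat * F)) :
  (nterms (sparse_poly s) <= count (predC1 0%R) (unzip2 s))%N.
Proof.
rewrite /sparse_poly; elim: s => [|[n c] s IH] /=.
  by rewrite big_nil /nterms polyseq0.
rewrite big_cons; apply: leq_trans (ntermsD _ _) (leq_add _ IH).
have sz : (size (c *: 'X^n) <= n.+1)%N.
  by rewrite (leq_trans (size_scale_leq _ _)) ?size_polyXn.
rewrite (nterms_sum sz) big_ord_recr big1 /= => [|i _].
  by rewrite coefZ coefXn eqxx mulr1.
by rewrite coefZ coefXn ltn_eqF ?mulr0 ?eqxx.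
Qed.

Lemma coef_recip_poly (F : nzRingType) (n : nat) (f : {poly F}) i :
  (size f <= n.+1)%N ->
  (recip_poly n f)`_i = if (i <= n)%N then f`_(n - i) else 0.
Proof.
move=> sz; rewrite /recip_poly (big_ord_widen _ (fun j => f`_j *: 'X^(n - j)) sz).
rewrite big_mkcond coef_sum; case: leqP => [le_in|lt_ni].
  have lt_ni : (n - i < n.+1)%N by lia.
  rewrite (bigD1 (Ordinal lt_ni)) //= big1 ?addr0 => [|j].
    case: ltnP => [_|le_f]; last by rewrite coef0 nth_default.
    by rewrite coefZ coefXn subKn // eqxx mulr1.
  rewrite -val_eqE /= => ne_j; case: ifP => _; last exact: coef0.
  have := ltn_ord j; rewrite coefZ coefXn => lt_j.
  by case: eqP => [ij|_]; [lia | rewrite mulr0].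
apply: big1 => j _; case: ifP => _; last exact: coef0.
by rewrite coefZ coefXn gtn_eqF ?mulr0 //; lia.
Qed.

Lemma nterms_recip_poly (F : nzRingType) (n : nat) (f : {poly F}) :
  (size f <= n.+1)%N -> nterms (recip_poly n f) = nterms f.
Proof.
move=> sz; have sz' : (size (recip_poly n f) <= n.+1)%N.
  by apply/leq_sizeP => i lt_ni; rewrite coef_recip_poly // leqNgt lt_ni.
rewrite (nterms_sum sz) (nterms_sum sz') (reindex_inj rev_ord_inj) /=.
apply: eq_bigr => i _; rewrite coef_recip_poly // subSS leq_subr subKn //.
by rewrite -ltnS.
Qed.

Lemma horner_recip_poly (F : fieldType) (n : nat) (f : {poly F}) (x : F) :
  (size f <= n.+1)%N -> x != 0 ->
  (recip_poly n f).[x] = x ^+ n * f.[x^-1].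
Proof.
move=> sz x0; rewrite /recip_poly horner_sum horner_coef mulr_sumr.
apply: eq_bigr => i _; rewrite hornerZ hornerXn mulrCA; congr (_ * _).
have le_in : (i <= n)%N by rewrite -ltnS (leq_trans (ltn_ord i)).
by rewrite -{2}(subnK le_in) exprD -mulrA -exprMn divff // expr1n mulr1.
Qed.

(** * Closure properties of the prime field *)

Section PrimeSubfield.
Variables (p : nat) (F : nzRingType).
Hypothesis charF : p \in [pchar F].

Lemma in_Fp_nat k : in_Fp p (k%:R : F).
Proof.
exists k%:R; rewrite val_Fp_nat ?(pcharf_prime charF) //.
by rewrite {1}(divn_eq k p) natrD natrM (pcharf0 charF) mulr0 add0r.
Qed.

Lemma in_FpD (x y : F) : in_Fp p x -> in_Fp p y -> in_Fp p (x + y).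
Proof. by move=> [a ->] [b ->]; rewrite -natrD; apply: in_Fp_nat. Qed.

Lemma in_Fp_N1 : in_Fp p (-1 : F).
Proof.
suff <- : p.-1%:R = -1 :> F by apply: in_Fp_nat.
apply/eqP; rewrite -addr_eq0 natr1 prednK ?(pcharf0 charF) //.
exact/prime_gt0/(pcharf_prime charF).
Qed.

Lemma in_Fp_sparse_poly (s : seq (nat * F)) i :
  {subset unzip2 s <= [:: 0; 1; -1]} -> in_Fp p (sparse_poly s)`_i.
Proof.
elim: s => [_|[n c] s IH sub].
  by rewrite /sparse_poly big_nil coef0; apply: (in_Fp_nat 0).
rewrite coef_sparse_poly_cons; apply: in_FpD; last first.
  by apply: IH => x xs; apply: sub; rewrite inE xs orbT.
case: eqP => _; last exact: (in_Fp_nat 0).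
have := sub c (mem_head _ _); rewrite !inE.
case/or3P => /eqP ->; [exact: (in_Fp_nat 0) | exact: (in_Fp_nat 1) |].
exact: in_Fp_N1.
Qed.

End PrimeSubfield.

(** * The coefficients of [B] *)

Section Coefficients.
Variables (F : fieldType) (w : F) (Q R S : nat).
Hypotheses (prim_w : 3.-primitive_root w).
Hypotheses (Q3 : ~~ (3 %| Q)%N) (R3 : ~~ (3 %| R)%N) (S3 : ~~ (3 %| S)%N).

Lemma prim3_sqr : w ^+ 2 = - 1 - w.
Proof.
have w1 : w - 1 != 0.
  rewrite subr_eq0 -{1}(expr1 w) -(expr0 w) (eq_prim_root_expr prim_w) //.
apply: (mulfI w1); have := prim_expr_order prim_w => w3.
by apply/eqP; rewrite -subr_eq0; apply/eqP; ring: w3.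
Qed.

(** The two exponents of [w] differ mod 3. If [Q + R + S] is 1 mod 3, exactly two of the residues
    are 1 and the third is 2, and both positions of [S] separate [Q + R] from [S + 1]. *)
Lemma beta_neq0 : beta w Q R S != 0.
Proof.
rewrite /beta; case: ifP => /eqP hm; rewrite subr_eq0.
  by rewrite (eq_prim_root_expr prim_w); apply/eqP; lia.
rewrite -[X in _ == X](expr1 w) (eq_prim_root_expr prim_w); apply/eqP; lia.
Qed.

(** There are eight residue patterns of [Q], [R], [S] mod 3. In each of them every coefficient of
    [C1] is 0 or plus or minus [beta], and at least three vanish. Zero coefficients stay in the
    list, so that the exponents are the same in all cases. *)
Lemma B1_sparse : exists s : seq (nat * F),
  [/\ B w Q R S 1 = sparse_poly s,
      unzip1 s = [:: Q + R + S; Q + R; Q + S; R + S; Q; R; S; 0]%N,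
      {subset unzip2 s <= [:: 0; 1; -1]} &
      (count (predC1 0%R) (unzip2 s) <= 5)%N].
Proof.
(* An opaque [b] lets the reduction mod 3 act on its value in [bE] without touching the factors
   [b^-1]. *)
have [b bE] : exists b, b = beta w Q R S by exists (beta w Q R S).
have b0 : b != 0 by rewrite bE beta_neq0.
exists [:: ((Q + R + S)%N, b^-1 * (w ^+ (Q + R + S) - w));
  ((Q + R)%N, b^-1 * (w ^+ (Q + R) - w ^+ (S + 1)));
  ((Q + S)%N, b^-1 * (w ^+ (Q + S) - w ^+ (R + 1)));
  ((R + S)%N, b^-1 * (w ^+ (R + S) - w ^+ (Q + 1)));
  (Q, b^-1 * (w ^+ Q - w ^+ (R + S + 1)));
  (R, b^-1 * (w ^+ R - w ^+ (Q + S + 1)));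
  (S, b^-1 * (w ^+ S - w ^+ (Q + R + 1)));
  (0%N, b^-1 * (1 - w ^+ (Q + R + S + 1)))].
split=> //=.
  rewrite /B /C1 /sparse_poly !big_cons big_nil /= -alg_polyC !scalerDr -bE.
  by rewrite !scalerA expr0 addr0 !addrA.
all: move: bE; rewrite /beta; case: ifP => /eqP hm.
all: have w2 := prim3_sqr; have modw := prim_expr_mod prim_w.
all: have [rQ|rQ] : (Q %% 3 = 1 \/ Q %% 3 = 2)%N by lia.
all: have [rR|rR] : (R %% 3 = 1 \/ R %% 3 = 2)%N by lia.
all: have [rS|rS] : (S %% 3 = 1 \/ S %% 3 = 2)%N by lia.
all: try (exfalso; lia).
all: rewrite !exprD -(modw Q) -(modw R) -(modw S) rQ rR rS => bE.
all: have k0 N : N = 0 -> b^-1 * N = 0 by move=> ->; rewrite mulr0.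
all: have k1 N : N = b -> b^-1 * N = 1 by move=> ->; rewrite mulVf.
all: have kN N : N = - b -> b^-1 * N = - 1 by move=> ->; rewrite mulrN mulVf.
all: repeat match goal with
  | bE : ?b = _, w2 : _ ^+ 2 = _,
    k0 : (forall N, N = 0 -> ?b^-1 * N = 0),
    k1 : (forall N, N = ?b -> ?b^-1 * N = 1),
    kN : (forall N, N = - ?b -> ?b^-1 * N = - 1) |- context [?b^-1 * ?N] =>
  first [ rewrite (k0 N); last by ring: w2
        | rewrite (k1 N); last by rewrite bE; ring: w2
        | rewrite (kN N); last by rewrite bE; ring: w2 ] end.
all: try by rewrite ?oppr_eq0 ?oner_eq0 ?eqxx.
all: by apply/allP; rewrite /= !inE !eqxx ?orbT.
Qed.

End Coefficients.

(** * Values of [C1] and [C2], and the Frobenius map on values *)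

Section Evaluation.
Variables (p : nat) (F : fieldType) (w : F) (Q R S : nat).
Hypothesis charF : p \in [pchar F].
Hypotheses (pQ : p.-nat Q) (pR : p.-nat R) (pS : p.-nat S).

(** Raising to each of [Q], [R], [S] is additive, so each [n]-th power on the right is a product of
    three binomials; expanding gives the eight monomials of [C1]. *)
Lemma horner_C1 (x : F) :
  (C1 w Q R S).[x] =
  (w * x + 1) ^+ (Q + R + S) - w * (x + w) ^+ (Q + R + S).
Proof.
rewrite /C1 !hornerE /= !exprD expr1 !(exprD_pnat _ _ charF) // !exprMn !expr1n; ring.
Qed.

(** Multiplying by [x] after inverting [x] exchanges [w * x + 1] and [x + w]. *)
Lemma horner_C2 (x : F) : x != 0 ->
  (C2 w Q R S).[x] =
  (x + w) ^+ (Q + R + S) - w * (w * x + 1) ^+ (Q + R + S).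
Proof.
move=> x0; rewrite /C2 horner_recip_poly ?size_C1 // horner_C1.
rewrite mulrBr (mulrCA _ w) -!exprMn !mulrDr mulrCA divff // !mulr1.
by rewrite (addrC w) (addrC 1) (mulrC x).
Qed.

End Evaluation.

Lemma horner_in_Fp_exp (p q : nat) (F : fieldType) (f : {poly F}) (x : F) :
  p \in [pchar F] -> p.-nat q -> (forall i, in_Fp p f`_i) ->
  f.[x] ^+ q = f.[x ^+ q].
Proof.
move=> charF pq fp.
have q0 : (0 < q)%N by move: pq; rewrite /pnat => /andP[].
have natX k : (k%:R : F) ^+ q = k%:R.
  elim: k => [|k IH]; first by rewrite expr0n eqn0Ngt q0.
  by rewrite -natr1 (exprD_pnat _ _ charF) // IH expr1n.
rewrite !horner_coef (big_morph (fun a => a ^+ q) (id1 := 0) (op1 := +%R)).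
- apply: eq_bigr => i _; rewrite exprMn exprAC; congr (_ * _).
  by have [a ->] := fp i; apply: natX.
- by move=> a b; apply: exprD_pnat charF pq.
- exact: (natX 0%N).
Qed.

(* The Moebius map [x |-> (w x + 1) / (x + w)] is handled through its numerator
   and denominator, so that its pole at [x = -w] needs no special treatment.
   It sends the [q + 1]-st roots of unity to the [m]-th roots of unity,
   together with [0] and infinity when [m = q - 1]. *)
Section Moebius.
Variables (F : finFieldType) (w : F) (q m n : nat).
Hypotheses (prim_w : 3.-primitive_root w) (q0 : (0 < q)%N) (n0 : (0 < n)%N).
Hypothesis cardF : #|F| = (q ^ 2)%N.
Hypothesis frobD : forall a b : F, (a + b) ^+ q = a ^+ q + b ^+ q.
Hypothesis wq_m :
  (w ^+ q = w /\ m = (q + 1)%N) \/ (w ^+ q = w ^+ 2 /\ m = (q - 1)%N).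

Let u x := w * x + 1.
Let v x := x + w.

Let w2 : w ^+ 2 = - 1 - w.
Proof. exact: prim3_sqr. Qed.

Let w_neq0 : w != 0.
Proof. by rewrite (prim_root_eq0 prim_w). Qed.

Let w_neq1 : w != 1.
Proof. by rewrite -[X in X == _]expr1 -(prim_order_dvd prim_w). Qed.

Let w2_neq1 : w ^+ 2 != 1.
Proof. by rewrite -(prim_order_dvd prim_w). Qed.

Let frobB (a b : F) : (a - b) ^+ q = a ^+ q - b ^+ q.
Proof. by apply: (addIr (b ^+ q)); rewrite -frobD !subrK. Qed.

(** Here [w ^+ m] is [w ^+ 2] or [w]. That [w] is not an [m]-th root of unity keeps the inverse
    Moebius map off its pole and [C1], [C2] off zero. *)
Let wm_neq1 : w ^+ m != 1.
Proof.
case: wq_m => -[wq ->]; first by rewrite exprD wq expr1 -expr2.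
apply: contraNneq w_neq1 => wq1; apply/eqP; apply: (mulfI w_neq0).
by rewrite mulr1 -expr2 -wq -(subnK q0) exprD wq1 mul1r expr1.
Qed.

Let mu_neq0 (x : F) : x ^+ (q + 1) = 1 -> x != 0.
Proof.
by apply: contra_eq_neq => ->; rewrite expr0n addn1 eq_sym oner_eq0.
Qed.

(** The Moebius map has determinant [w ^+ 2 - 1], which is nonzero. *)
Lemma moebius_num_den_neq0 (x : F) : (u x != 0) || (v x != 0).
Proof.
rewrite -negb_and; apply: contraNN w2_neq1 => /andP[/eqP ux /eqP vx].
have -> : w ^+ 2 = w * v x - u x + 1 by rewrite /u /v; ring.
by rewrite ux vx mulr0 subrr add0r.
Qed.

(** Here [x ^+ q] is the inverse of [x]. If [w ^+ q = w], then [x * u x ^+ q = v x] and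
    [x * v x ^+ q = u x]; if [w ^+ q = w ^+ 2], then both [u x] and [v x] have [(q - 1)]-st power
    [w ^+ 2 / x]. *)
Lemma moebius_exp (x : F) : x ^+ (q + 1) = 1 ->
  u x != 0 -> v x != 0 -> u x ^+ m = v x ^+ m.
Proof.
move=> xq u0 v0; have x0 := mu_neq0 xq.
have xqx : x * x ^+ q = 1 by rewrite -exprS -addn1.
have xuq : x * u x ^+ q = w ^+ q + x.
  by rewrite /u frobD exprMn expr1n mulrDr mulrCA xqx !mulr1.
have xvq : x * v x ^+ q = 1 + x * w ^+ q by rewrite /v frobD mulrDr xqx.
case: wq_m => -[wq ->].
  apply: (mulfI x0); rewrite !exprD !expr1 !mulrA xuq xvq wq /u /v; ring.
have expP a : a != 0 -> x * a ^+ q = w ^+ 2 * a -> a ^+ (q - 1) = w ^+ 2 / x.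
  move=> a0 xaq; apply: (mulfI x0); apply: (mulIf a0).
  by rewrite mulrCA divff // mulr1 -xaq -mulrA -exprSr -addn1 subnK.
rewrite (expP _ u0) ?(expP _ v0) // ?xuq ?xvq wq /u /v; ring: w2.
Qed.

(** The quotient is the preimage of [a] under the Moebius map; its numerator and denominator have
    the same [(q + 1)]-st power. *)
Lemma moebius_inv_mem (a : F) : a ^+ m = 1 ->
  a - w != 0 /\ ((1 - w * a) / (a - w)) ^+ (q + 1) = 1.
Proof.
move=> am.
have aw0 : a - w != 0.
  by rewrite subr_eq0; apply: contraNneq wm_neq1 => <-; apply/eqP.
split=> //; rewrite expr_div_n; apply: canLR (mulfK _) _.
  by rewrite expf_neq0.
rewrite mul1r !addn1 !exprSr !frobB expr1n exprMn.
case: wq_m am => -[wq ->] am.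
  have a0 : a != 0 by apply: mu_neq0.
  have aqa : a * a ^+ q = 1 by rewrite -exprS -addn1.
  by apply: (mulfI a0); rewrite wq; ring: aqa.
have -> : a ^+ q = a by rewrite -(subnK q0) exprD am mul1r expr1.
by apply: (mulfI w_neq0); rewrite wq; ring: w2.
Qed.

(** If [a ^+ n = w * b ^+ n], with [a] and [b] not both zero, then neither is zero; taking [m]-th
    powers gives [w ^+ m = 1]. *)
Lemma moebius_exp_sub_neq0 (x : F) : x ^+ (q + 1) = 1 ->
  u x ^+ n - w * v x ^+ n != 0 /\ v x ^+ n - w * u x ^+ n != 0.
Proof.
move=> xq; have uv0 := moebius_num_den_neq0 x.
have sub0 (a b : F) : (a != 0) || (b != 0) ->
    (a != 0 -> b != 0 -> a ^+ m = b ^+ m) -> a ^+ n - w * b ^+ n != 0.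
  move=> ab0 abm; rewrite subr_eq0; apply/negP => /eqP abn.
  have b0 : b != 0.
    apply/negP => /eqP b0; move: ab0 abn; rewrite b0 eqxx orbF.
    rewrite expr0n eqn0Ngt n0 mulr0 => a0 /eqP.
    by rewrite expf_eq0 (negPf a0) andbF.
  have a0 : a != 0.
    apply/negP => /eqP a0; move/eqP: abn; rewrite a0 expr0n eqn0Ngt n0 eq_sym.
    by rewrite mulf_eq0 (negPf w_neq0) expf_eq0 (negPf b0) andbF.
  have : a ^+ m ^+ n = w ^+ m * b ^+ m ^+ n.
    by rewrite (exprAC _ m n) abn exprMn (exprAC _ n m).
  rewrite abm // -[LHS]mul1r => /mulIf wm1; move: wm_neq1.
  by rewrite -wm1 ?eqxx ?expf_neq0.
split; apply: sub0 => //; first exact: moebius_exp.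
- by rewrite orbC.
- by move=> v0 u0; rewrite moebius_exp.
Qed.

(** This is injectivity of the [n]-th power on the image of the Moebius map, cross-multiplied. A
    common nontrivial [n]-th and [m]-th root of unity gives a collision with 1; conversely, finite
    nonzero image points are [m]-th roots of unity. *)
Lemma moebius_exp_inj :
  (forall x y : F, x ^+ (q + 1) = 1 -> y ^+ (q + 1) = 1 ->
     (v x * u y) ^+ n = (v y * u x) ^+ n -> x = y) <-> coprime n m.
Proof.
split=> [inj | co x y xq yq eqn].
  apply: contraT => /(finField_root_of_unity_neq1 (F := F)).
  have -> : (m %| #|F|.-1)%N.
    have -> : #|F|.-1 = ((q + 1) * (q - 1))%N by rewrite cardF; nia.
    by case: wq_m => -[_ ->]; [apply: dvdn_mulr | apply: dvdn_mull].
  move=> /(_ isT)[a [a1 am an]].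
  have [aw0 xq] := moebius_inv_mem am.
  have w10 : 1 + w != 0.
    have -> : 1 + w = - w ^+ 2 by ring: w2.
    by rewrite oppr_eq0 expf_neq0.
  case/negP: a1; apply/eqP; apply: (mulIf w10); rewrite mul1r.
  (* The point 1 is fixed by the Moebius map, since [u 1 = v 1 = 1 + w]; so the preimage of [a] is 1
     only if [a = 1]. *)
  suff eq1 : (1 - w * a) / (a - w) = 1.
    apply/eqP; rewrite -subr_eq0; apply/eqP.
    have -> : a * (1 + w) - (1 + w) = a - w - (1 - w * a) by ring.
    by rewrite (divr1_eq eq1) subrr.
  apply: inj => //; first by rewrite expr1n.
  set x := _ / _.
  have -> : v 1 * u x = a * (v x * u 1) by rewrite /u /v /x; field.
  by rewrite [RHS]exprMn an mul1r.
have xy_eq : v x * u y = v y * u x -> x = y.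
  move=> e; apply/eqP; rewrite -subr_eq0; apply/eqP.
  have w2' : w ^+ 2 - 1 != 0 by rewrite subr_eq0.
  apply: (mulfI w2'); rewrite mulr0.
  have -> : (w ^+ 2 - 1) * (x - y) = v y * u x - v x * u y.
    by rewrite /u /v; ring.
  by rewrite e subrr.
apply: xy_eq.
(* When some factor vanishes (image 0 or infinity), the equation of [n]-th powers makes both
   products zero, hence equal. *)
have nz (a b c d : F) : (a * b) ^+ n = (c * d) ^+ n -> a = 0 -> c * d = 0.
  move=> e a0; move/eqP: e; rewrite a0 mul0r expr0n eqn0Ngt n0 eq_sym.
  by rewrite expf_eq0 => /andP[_ /eqP].
have [vx|vx] := eqVneq (v x) 0; first by rewrite (nz _ _ _ _ eqn vx) vx mul0r.
have [uy|uy] := eqVneq (u y) 0.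
  by rewrite mulrC in eqn; rewrite (nz _ _ _ _ eqn uy) uy mulr0.
have [vy|vy] := eqVneq (v y) 0.
  by rewrite (nz _ _ _ _ (esym eqn) vy) vy mul0r.
have [ux|ux] := eqVneq (u x) 0.
  by rewrite (mulrC (v y)) in eqn *; rewrite (nz _ _ _ _ (esym eqn) ux) ux mul0r.
apply: (expf_coprime_inj n0 co) => //; first by rewrite mulf_neq0.
by rewrite !exprMn -(moebius_exp xq) // -(moebius_exp yq) // mulrC.
Qed.

End Moebius.

(** * Arithmetic of the exponents and assembly of the theorem *)

(** The sum exceeds its smaller term [p ^ a], so as a power of [p] it would be divisible by
    [p ^ a.+1], and so would [p ^ a]. *)
Lemma prime_pow_add_neq (p T U V : nat) : prime p ->
  (exists i, T = (p ^ i)%N) -> (exists i, U = (p ^ i)%N) ->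
  (exists i, V = (p ^ i)%N) -> T <> U -> (T + U)%N <> V.
Proof.
move=> p_pr [a ->] [b ->] [c ->].
wlog lt_ab : a b / (a < b)%N.
  move=> H ne; case: (ltngtP a b) => [/H|/H|e]; first exact.
    by rewrite addnC; apply; apply/nesym.
  by case: ne; rewrite e.
move=> _ e; have p1 := prime_gt1 p_pr.
have lt_ac : (a < c)%N.
  rewrite -(ltn_exp2l _ _ p1) -e -[X in (X < _)%N]addn0 ltn_add2l.
  by rewrite expn_gt0 ltnW.
have : (p ^ a.+1 %| p ^ a)%N.
  by rewrite -(dvdn_addl _ (dvdn_exp2l p lt_ab)) e dvdn_exp2l.
by rewrite dvdn_Pexp2l // ltnn.
Qed.

Lemma uniq_subset_sums (Q R S : nat) :
  (0 < Q)%N -> (0 < R)%N -> (0 < S)%N -> Q <> R -> Q <> S -> R <> S ->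
  (Q + R)%N <> S -> (Q + S)%N <> R -> (R + S)%N <> Q ->
  uniq [:: Q + R + S; Q + R; Q + S; R + S; Q; R; S; 0]%N.
Proof.
move=> Q0 R0 S0 QR QS RS QRS QSR RSQ; rewrite /= !inE !negb_or.
by do ![apply/andP; split]; try apply/eqP; lia.
Qed.

(** Translates the sign [e] into the two cases of the Moebius argument. *)
Lemma prim3_exp_mod3 (F : nzRingType) (w : F) (q : nat) (e : int) :
  3.-primitive_root w -> (0 < q)%N -> e = 1 \/ e = -1 ->
  (q%:Z = e %[mod 3])%Z ->
  let m := `|(q%:Z + e)%R|%N in
  (w ^+ q = w /\ m = (q + 1)%N) \/ (w ^+ q = w ^+ 2 /\ m = (q - 1)%N).
Proof.
move=> prim_w q0 [] -> qe m; [left | right];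
  rewrite -(prim_expr_mod prim_w q) /m; split; try lia.
  by have -> : (q %% 3 = 1)%N by lia.
by have -> : (q %% 3 = 2)%N by lia.
Qed.

(* [(1 - w t) / (t - w)] is injective in [t = ((w x + 1) / (x + w)) ^+ n]. *)
Lemma ratio_eq_moebius (F : fieldType) (w : F) (n : nat) (x y : F) :
  w ^+ 2 != 1 ->
  let u := fun x => w * x + 1 in let v := fun x => x + w in
  (v x ^+ n - w * u x ^+ n) * (u y ^+ n - w * v y ^+ n) =
  (v y ^+ n - w * u y ^+ n) * (u x ^+ n - w * v x ^+ n) <->
  (v x * u y) ^+ n = (v y * u x) ^+ n.
Proof.
move=> w2 u v; rewrite !exprMn.
have w20 : 1 - w ^+ 2 != 0 by rewrite subr_eq0 eq_sym.
set vx := v x ^+ n; set ux := u x ^+ n; set vy := v y ^+ n; set uy := u y ^+ n.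
have E : (vx - w * ux) * (uy - w * vy) - (vy - w * uy) * (ux - w * vx) =
  (1 - w ^+ 2) * (vx * uy - vy * ux) by ring.
split=> e; apply/eqP; rewrite -subr_eq0.
  by move/eqP: E; rewrite e subrr eq_sym mulf_eq0 (negPf w20).
by rewrite E e subrr mulr0.
Qed.

Theorem theorem1p1 (p k q Q R S r : nat) (F : finFieldType) (w : F)
    (hp : prime p) (hp3 : p <> 3%N)
    (hk : (0 < k)%N) (hq : q = (p ^ k)%N) (hF : #|F| = (q ^ 2)%N)
    (hQ : exists i : nat, Q = (p ^ i)%N)
    (hR : exists i : nat, R = (p ^ i)%N)
    (hS : exists i : nat, S = (p ^ i)%N)
    (hw : 3.-primitive_root w)
    (hr : (0 < r)%N) (hrQRS : r = Q + R + S %[mod q + 1])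
    (z : nat) (hz : z = 1%N \/ z = 2%N) :
  [/\ (nterms (B w Q R S z) <= 5)%N,
      (forall i : nat, in_Fp p (B w Q R S z)`_i) &
      (Q <> R -> Q <> S -> R <> S ->
       forall i : nat, (B w Q R S z)`_i <> 0 ->
         (B w Q R S z)`_i = 1 \/ (B w Q R S z)`_i = -1)]
  /\
  (forall e : int, e = 1 \/ e = -1 -> (q%:Z = e %[mod 3])%Z ->
     permutes ('X^r * (B w Q R S z \Po 'X^(q - 1)))
     <-> gcdn r (q - 1) = 1%N /\ gcdz (Q + R + S)%:Z (q%:Z + e) = 1).
Proof.
have charF : p \in [pchar F].
  by apply: (@card_finPcharP F p (k * 2)) => //; rewrite expnM -hq.
have pow3 T : (exists i, T = (p ^ i)%N) -> ~~ (3 %| T)%N.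
  move=> [i ->]; rewrite Euclid_dvdX // dvdn_prime2 //.
  by case: eqP => // e; case: hp3.
have pow_nat T : (exists i, T = (p ^ i)%N) -> p.-nat T.
  by move=> [i ->]; rewrite pnatX pnat_id.
have pos T : (exists i, T = (p ^ i)%N) -> (0 < T)%N.
  by move=> [i ->]; rewrite expn_gt0 prime_gt0.
set n := (Q + R + S)%N; set b := beta w Q R S.
have b0 : b != 0 by rewrite beta_neq0 ?pow3.
have szC1 : (size (C1 w Q R S) <= n.+1)%N := size_C1 w Q R S.
have [s [B1E s1 s2 s5]] := B1_sparse hw (pow3 _ hQ) (pow3 _ hR) (pow3 _ hS).
have szB1 : (size (B w Q R S 1) <= n.+1)%N.
  exact: leq_trans (size_scale_leq _ _) szC1.
have B2E : B w Q R S 2 = recip_poly n (B w Q R S 1).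
  apply/polyP => i; rewrite coefZ !coef_recip_poly //; case: ifP => _.
    by rewrite coefZ.
  by rewrite mulr0.
(* Reversal only permutes coefficients and pads with zeros, so coefficient claims need proof only
   for index 1. *)
have coefB2 (P : F -> Prop) :
    P 0 -> (forall i, P (B w Q R S 1)`_i) -> forall i, P (B w Q R S z)`_i.
  move=> P0 P1 i; case: hz => -> //.
  by rewrite B2E coef_recip_poly //; case: ifP.
have FpB : forall i, in_Fp p (B w Q R S z)`_i.
  apply: coefB2 => [|i]; first exact: (in_Fp_nat charF 0).
  by rewrite B1E; apply: in_Fp_sparse_poly.
split.
  split=> //.
    case: hz => ->; rewrite ?B2E ?nterms_recip_poly // B1E;
    exact: leq_trans (nterms_sparse_poly s) s5.
  move=> QR QS RS; apply: (coefB2 (fun c => c <> 0 -> c = 1 \/ c = -1)) => // i.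
  have : uniq (unzip1 s).
    by rewrite s1 uniq_subset_sums ?pos //; apply: prime_pow_add_neq hp _ _ _ _.
  rewrite B1E => /(coef_sparse_poly_uniq i) [->|/s2] //.
  by rewrite !inE => /or3P[] /eqP ->; auto.
move=> e he qe.
have q1 : (1 < q)%N by rewrite hq -(exp1n k) ltn_exp2r ?prime_gt1.
have pq : p.-nat q by apply: pow_nat; exists k.
have frobD (a c : F) : (a + c) ^+ q = a ^+ q + c ^+ q.
  exact: exprD_pnat charF pq.
set m := `|(q%:Z + e)%R|%N; have wq_m := prim3_exp_mod3 hw (ltnW q1) he qe.
have n0 : (0 < n)%N by rewrite !addn_gt0 pos.
have q0 := ltnW q1.
have gcdE : gcdz (Q + R + S)%:Z (q%:Z + e) = 1 <-> coprime n m.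
  rewrite /gcdz /coprime -/m.
  by split=> [[->] | /eqP] //= ->.
have mu_neq0 (x : F) : x ^+ (q + 1) = 1 -> x != 0.
  by apply: contra_eq_neq => ->; rewrite expr0n addn1 eq_sym oner_eq0.
pose N z' x := (if z' == 1%N then (w * x + 1) ^+ n - w * (x + w) ^+ n
  else (x + w) ^+ n - w * (w * x + 1) ^+ n) : F.
have hE (x : F) : x ^+ (q + 1) = 1 -> (B w Q R S z).[x] = b^-1 * N z x.
  move=> /mu_neq0 x0; rewrite hornerZ; congr (_ * _).
  case: hz => -> /=; first by rewrite (horner_C1 w charF) ?pow_nat.
  by rewrite (horner_C2 w charF) ?pow_nat.
(* Frobenius inverts [x] and fixes the coefficients, so up to the factor [x ^+ n] it exchanges the
   two polynomials; [3 - z] is the other index. *)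
have hq' (x : F) : x ^+ (q + 1) = 1 ->
    x ^+ n * (B w Q R S z).[x] ^+ q = b^-1 * N (3 - z)%N x.
  move=> xq; have x0 := mu_neq0 _ xq; have xV0 : x^-1 != 0 by rewrite invr_eq0.
  rewrite (horner_in_Fp_exp _ charF) //.
  have -> : x ^+ q = x^-1.
    by apply: (mulfI x0); rewrite divff // -exprS -addn1.
  rewrite hornerZ mulrCA; congr (_ * _); case: hz => -> /=.
    by rewrite -horner_recip_poly // (horner_C2 w charF) ?pow_nat.
  rewrite /C2 horner_recip_poly // invrK mulrA -exprMn divff // expr1n mul1r.
  by rewrite (horner_C1 w charF) ?pow_nat.
have N0 z' x : x ^+ (q + 1) = 1 -> N z' x != 0.
  move=> xq; rewrite /N.
  have [? ?] := moebius_exp_sub_neq0 hw q0 n0 frobD wq_m xq.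
  by case: ifP.
have h0 (x : F) : x ^+ (q + 1) = 1 -> (B w Q R S z).[x] != 0.
  by move=> xq; rewrite hE // mulf_neq0 ?invr_eq0 ?N0.
have gE (x : F) : x ^+ (q + 1) = 1 ->
    x ^+ r * (B w Q R S z).[x] ^+ (q - 1) = N (3 - z)%N x / N z x.
  move=> xq; apply: (mulIf (h0 _ xq)).
  rewrite -mulrA -exprSr subn1 prednK //.
  (* Only [r] mod [q + 1] matters on these roots of unity. *)
  have -> : x ^+ r = x ^+ n.
    by rewrite -(expr_mod r xq) hrQRS expr_mod.
  by rewrite hq' // hE // mulrCA divfK // N0.
have dF : ((q + 1) * (q - 1))%N = #|F|.-1 by rewrite hF mulnC -subn_sqr exp1n subn1.
have w2 : w ^+ 2 != 1 by rewrite -(prim_order_dvd hw).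
rewrite (permutes_comp_exp hr dF h0) gcdE.
rewrite -(moebius_exp_inj hw q0 n0 hF frobD wq_m).
have colE x y : x ^+ (q + 1) = 1 -> y ^+ (q + 1) = 1 ->
  x ^+ r * (B w Q R S z).[x] ^+ (q - 1) = y ^+ r * (B w Q R S z).[y] ^+ (q - 1)
  <-> ((x + w) * (w * y + 1)) ^+ n = ((y + w) * (w * x + 1)) ^+ n.
  move=> xq yq; rewrite !gE // -(ratio_eq_moebius n x y w2).
  have Nx := N0 z x xq; have Ny := N0 z y yq.
  rewrite (rwP eqP) eqr_div // -(rwP eqP) /N; case: hz => -> /=; first by [].
  (* For index 2 both ratios are inverted, and cross-multiplying yields the same equation with its
     factors swapped. *)
  by split=> e2; rewrite mulrC -e2 mulrC.
split=> [[/eqP co inj] | [/eqP co inj]]; split=> //.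
- by move=> x y xq yq /(colE x y xq yq); apply: inj.
- by move=> x y xq yq /(colE x y xq yq); apply: inj.
Qed.
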